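(* Let $(\mathcal S,\tilde\phi,\tilde g)$ be an almost para-Hermitian manifold of real dimension $2$, $(\mathcal M,\phi,g)$ an almost para-Hermitian manifold of real dimension $4$, and $f:\mathcal S\to\mathcal M$ an isometric immersion which is slant at $p\in\mathcal S$ with slant factor $\lambda\in\mathbb R$. Put $q=f(p)$. Let $(v_1,v_2)$ be an orthonormal frame of $T_p\mathcal S$ with $v_2=\tilde\phi v_1$, $\tilde g(v_1,v_1)=1$, $\tilde g(v_2,v_2)=-1$, and set $e_1=f_*(v_1)$, $e_2=f_*(v_2)$. Then there exists an orthonormal frame $(e_3,e_4)$ of the normal plane $N_qf$, with $g(e_3,e_3)=1$, $g(e_4,e_4)=-1$, such that: (1) if $|\lambda|>1$, then with $c_\lambda=\sqrt{\lambda^2-1}$, $$\phi e_1=\lambda e_2+c_\lambda e_3,\quad \phi e_2=\lambda e_1+c_\lambda e_4,\quad \phi e_3=-c_\lambda e_1-\lambda e_4,\quad \phi e_4=-c_\lambda e_2-\lambda e_3;$$ (2) if $|\lambda|<1$, then with $c_\lambda=\sqrt{1-\lambda^2}$, $$\phi e_1=\lambda e_2+c_\lambda e_4,\quad \phi e_2=\lambda e_1+c_\lambda e_3,\quad \phi e_3=c_\lambda e_2-\lambda e_4,\quad \phi e_4=c_\lambda e_1-\lambda e_3;$$ (3) if $|\lambda|=1$, then for some $\epsilon\in\{1,-1\}$ and some $a_0\in\mathbb R$, $$\phi e_1=\lambda e_2+a_0(e_3+e_4),\quad \phi e_2=\lambda e_1-\tfrac{\epsilon}{\lambda}a_0(e_3+e_4),$$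 $$\phi e_3=\epsilon e_4-a_0\bigl(e_1+\tfrac{\epsilon}{\lambda}e_2\bigr),\quad \phi e_4=\epsilon e_3+a_0\bigl(e_1+\tfrac{\epsilon}{\lambda}e_2\bigr).$$
   Context: All manifolds are smooth and connected. An almost para-Hermitian manifold $(\mathcal M,\phi,g)$ is a manifold of even dimension $2n\ge 2$ with a pseudo-Riemannian metric $g$ of signature $(n,n)$ and a $(1,1)$-tensor field $\phi$ such that $\phi^2=\mathrm{Id}$, the $+1$ and $-1$ eigenspaces of $\phi$ at each point have equal dimension, and $g(\phi X,\phi Y)=-g(X,Y)$ for all vector fields $X,Y$ (hence $g(\phi X,Y)+g(X,\phi Y)=0$). Isometric immersion means $\tilde g=f^*g$. For $p\in\mathcal S$, $q=f(p)$, let $T_qf=f_*(T_p\mathcal S)\subset T_q\mathcal M$ and let $N_qf$ be its $g$-orthogonal complement in $T_q\mathcal M$. The normal map is the linear map $A:T_qf\to N_qf$ sending $f_*(v)$ to the orthogonal projection of $\phi f_*(v)$ onto $N_qf$. For a surface $\mathcal S$ in a four-dimensional $\mathcal M$, $f$ being slant at $p$ with slant factor $\lambda\in\mathbb R$ means that $$\phi f_*(v)=\lambda f_*(\tilde\phi v)+Af_*(v)\qquad\text{for all } v\in T_p\mathcal S.$$ *)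

(* Defs.v *)
From HB Require Import structures.
From mathcomp Require Import all_boot all_order all_algebra sesquilinear.
From mathcomp Require Import all_classical all_reals interval_inference topology normedtype landau derive.

Set Implicit Arguments.
Unset Strict Implicit.
Unset Printing Implicit Defensive.

Import Order.TTheory GRing.Theory Num.Theory.
Import numFieldNormedType.Exports.

Local Open Scope classical_set_scope.
Local Open Scope ring_scope.

Section Calculus.
Context {R : realType} {V W : normedModType R}.

(* Only used with U open: continuity and differentiability are required at
   the points of U in the ambient space, not relatively to U. *)
Fixpoint Ck_on (k : nat) (U : set V) (f : V -> W) : Prop :=
  match k with
  | 0 => forall x, U x -> {for x, continuous f}
  | k'.+1 => (forall x, U x -> differentiable f x) /\
             (forall v, Ck_on k' U ('D_v f))
  end.

Definition smooth_on (U : set V) (f : V -> W) := forall k, Ck_on k U f.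

Lemma smooth_on_diff (U : set V) (f : V -> W) x :
  smooth_on U f -> U x -> differentiable f x.
Proof. by move=> /(_ 1%N)[+ _]; apply. Qed.

Lemma near_eq_differential (f g : V -> W) (x : V) :
  (\forall y \near x, f y = g y) -> differentiable f x ->
  differentiable g x /\ 'd g x = 'd f x :> (V -> W).
Proof.
move=> fg df.
have fgx : f x = g x := nbhs_singleton fg.
have [dfc dfE] := (diff_locallyxP x f).1 df.
have gE : g \o shift x = cst (g x) + 'd f x +o_ 0 id.
  apply/eqaddoP => _/posnumP[e].
  have /eqaddoP/(_ _ (gt0 e)) : f \o shift x = cst (f x) + 'd f x +o_ 0 id.
    by apply/funext => h; exact: dfE.
  have fg0 : \forall h \near (0 : V), f (h + x) = g (h + x).
    by move: fg; rewrite (near_shift 0) subr0; apply: filterS.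
  apply: filter_app; apply: filterS fg0 => h /=.
  by rewrite /= !fctE /= -fgx => ->.
have dgE := diff_unique dfc gE.
by split; [apply/diff_locallyP; rewrite dgE; split; [exact: dfc|exact: gE]|exact: dgE].
Qed.

End Calculus.

(* cinv is only meaningful on the open set cmap @` cdom. *)
Record chart (R : realType) (m : nat) (M : topologicalType) := Chart {
  cdom : set M;
  cmap : M -> 'rV[R]_m;
  cinv : 'rV[R]_m -> M;
  cdom_open : open cdom;
  cimg_open : open (cmap @` cdom);
  cmapK : forall p, cdom p -> cinv (cmap p) = p;
  cmap_continuous : forall p, cdom p -> {for p, continuous cmap};
  cinv_continuous : forall x, (cmap @` cdom) x -> {for x, continuous cinv}
}.

(* The atlas is not required to be maximal: it presents the smooth structure
   of all charts compatible with it. *)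
Record manifold (R : realType) (m : nat) := Manifold {
  carrier :> topologicalType;
  atlas : set (chart R m carrier);
  manifold_hausdorff : hausdorff_space carrier;
  manifold_second_countable : @second_countable carrier;
  manifold_connected : connected [set: carrier];
  atlas_cover : forall p : carrier, exists c, atlas c /\ cdom c p;
  atlas_compatible : forall c d, atlas c -> atlas d ->
    smooth_on (cmap c @` (cdom c `&` cdom d)) (cmap d \o cinv c)
}.

Section Tangent.
Context {R : realType} {m : nat} (M : manifold R m).
Implicit Types (p : M) (c d : chart R m M).

Definition chart_around p : set (chart R m M) :=
  [set c | atlas c /\ cdom c p].

Definition some_chart p : chart R m M := projT1 (cid (atlas_cover p)).

Lemma some_chartP p : chart_around p (some_chart p).
Proof. exact: (projT2 (cid (atlas_cover p))). Qed.

Definition transition p c d : {linear 'rV[R]_m -> 'rV[R]_m} :=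
  'd (cmap d \o cinv c) (cmap c p).

Lemma near_cdom p c d : cdom c p -> cdom d p ->
  \forall x \near cmap c p, cdom d (cinv c x).
Proof.
move=> cp dp.
have /cinv_continuous : (cmap c @` cdom c) (cmap c p) by exists p.
by apply; rewrite /= cmapK//; apply: open_nbhs_nbhs; split=> //; exact: cdom_open.
Qed.

Lemma differentiable_transition p c d :
  chart_around p c -> chart_around p d ->
  differentiable (cmap d \o cinv c) (cmap c p).
Proof.
move=> [ac cp] [ad dp]; apply: smooth_on_diff (atlas_compatible ac ad) _.
by exists p.
Qed.

Lemma transition_comp p b c d v :
  chart_around p b -> chart_around p c -> chart_around p d ->
  transition p b d v = transition p c d (transition p b c v).
Proof.
move=> bp cp dp; rewrite /transition.
have dbc := differentiable_transition bp cp.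
have bK : (cmap c \o cinv b) (cmap b p) = cmap c p by rewrite /= cmapK//; case: bp.
have dcd : differentiable (cmap d \o cinv c) ((cmap c \o cinv b) (cmap b p)).
  by rewrite bK; exact: differentiable_transition.
have := diff_comp dbc dcd; rewrite bK => E.
have near_bd : \forall x \near cmap b p,
    ((cmap d \o cinv c) \o (cmap c \o cinv b)) x = (cmap d \o cinv b) x.
  have := near_cdom bp.2 cp.2; apply: filterS => x cx.
  by rewrite /= (cmapK cx).
have [_ bdE] := near_eq_differential near_bd (differentiable_comp dbc dcd).
exact: etrans (congr1 (@^~ v) bdE) (congr1 (@^~ v) E).
Qed.

Lemma transition_id p c v : chart_around p c -> transition p c c v = v.
Proof.
move=> [ac cp]; rewrite /transition.
have cidx : \forall x \near cmap c p, id x = (cmap c \o cinv c) x.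
  have : nbhs (cmap c p) (cmap c @` cdom c).
    by apply: open_nbhs_nbhs; split; [exact: cimg_open|exists p].
  by apply: filterS => _ [q cq <-] /=; rewrite cmapK.
have id_diff := is_diff_id (cmap c p).
have [_ ccE] := near_eq_differential cidx (ex_diff (is_diff_def := id_diff)).
exact: etrans (congr1 (@^~ v) ccE) (congr1 (@^~ v) (diff_val (is_diff_def := id_diff))).
Qed.

(* A tangent vector at p is the family, indexed by the charts c around p, of
   its coordinate vectors, subject to the usual transformation rule. Setting
   the other components to 0 makes equality of tangent vectors Leibniz. *)
Definition tangent_family p : {pred chart R m M -> 'rV[R]_m} :=
  fun v => `[< (forall c d, chart_around p c -> chart_around p d ->
                  v d = transition p c d (v c)) /\
               (forall c, ~ chart_around p c -> v c = 0) >].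

Record tangent p := Tangent {
  tangent_coord :> chart R m M -> 'rV[R]_m;
  tangent_coordP : tangent_coord \in tangent_family p
}.

HB.instance Definition _ p := [isSub for @tangent_coord p].
HB.instance Definition _ p := [Choice of tangent p by <:].

Lemma tangent_family_submod p : submod_closed (tangent_family p).
Proof.
split=> [|a u v].
  by apply/asboolP; split=> // c d _ _; rewrite linear0.
move=> /asboolP[u1 u0] /asboolP[v1 v0]; apply/asboolP; split=> [c d cp dp|c cp].
  by rewrite !fctE (u1 c d)// (v1 c d)// linearP.
by rewrite !fctE u0// v0// scaler0 addr0.
Qed.

HB.instance Definition _ p := GRing.isSubmodClosed.Build R
  (chart R m M -> 'rV[R]_m) (tangent_family p) (tangent_family_submod p).
HB.instance Definition _ p := [SubChoice_isSubLmodule of tangent p by <:].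


Lemma tangent_coordE p (v : tangent p) c d :
  chart_around p c -> chart_around p d -> v d = transition p c d (v c).
Proof. by case: v => v /= /asboolP[+ _]; apply. Qed.

Definition extend_coord p c (w : 'rV[R]_m) : chart R m M -> 'rV[R]_m :=
  fun d => if `[< chart_around p d >] then transition p c d w else 0.

Lemma extend_coordP p c w :
  chart_around p c -> extend_coord p c w \in tangent_family p.
Proof.
move=> cp; apply/asboolP; split=> [b d bp dp|b bp]; last first.
  by rewrite /extend_coord asboolF.
by rewrite /extend_coord !asboolT//; exact: transition_comp.
Qed.

Definition tangent_of p c (cp : chart_around p c) (w : 'rV[R]_m) : tangent p :=
  Tangent (extend_coordP w cp).

Lemma tangent_ofE p c (cp : chart_around p c) w : tangent_of cp w c = w.
Proof. by rewrite /= /extend_coord asboolT//; exact: transition_id. Qed.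

Lemma tangent_ofK p c (cp : chart_around p c) (v : tangent p) :
  tangent_of cp (v c) = v.
Proof.
apply/val_inj/funext => d /=; rewrite /extend_coord.
case: asboolP => dp; first by rewrite (tangent_coordE v cp dp).
by case: v => v /= /asboolP[_ ->].
Qed.

Fact tangent_vect_iso p : Vector.axiom m (tangent p).
Proof.
exists (fun v : tangent p => tangent_coord v (some_chart p)) => //.
exists (tangent_of (some_chartP p)) => [v|w]; first exact: tangent_ofK.
exact: tangent_ofE.
Qed.

HB.instance Definition _ p :=
  Lmodule_hasFinDim.Build R (tangent p) (tangent_vect_iso p).

Definition smooth_function_on (U : set M) (h : M -> R) :=
  forall c, atlas c -> smooth_on (cmap c @` (cdom c `&` U)) (h \o cinv c : _ -> R^o).

Definition vector_field := forall p : M, tangent p.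

Definition smooth_vector_field_on (U : set M) (X : vector_field) :=
  forall c, atlas c ->
    smooth_on (cmap c @` (cdom c `&` U)) (fun x => X (cinv c x) c).

End Tangent.

Record smooth_map (R : realType) (m n : nat) (S : manifold R m)
    (M : manifold R n) := SmoothMap {
  smooth_map_fun :> S -> M;
  smooth_map_continuous : continuous smooth_map_fun;
  smooth_map_smooth : forall c d, atlas c -> atlas d ->
    smooth_on (cmap c @` (cdom c `&` smooth_map_fun @^-1` cdom d))
              (cmap d \o smooth_map_fun \o cinv c)
}.

Section Pushforward.
Context {R : realType} {m n : nat} {S : manifold R m} {M : manifold R n}.
Variables (f : smooth_map S M) (p : S).

Definition local_diff (c : chart R m S) (d : chart R n M)
  : {linear 'rV[R]_m -> 'rV[R]_n} := 'd (cmap d \o f \o cinv c) (cmap c p).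

Lemma differentiable_local c d : chart_around p c -> chart_around (f p) d ->
  differentiable (cmap d \o f \o cinv c) (cmap c p).
Proof.
move=> [ac cp] [ad dp]; apply: smooth_on_diff (smooth_map_smooth f ac ad) _.
by exists p.
Qed.

Lemma local_diff_transl c d d' v :
  chart_around p c -> chart_around (f p) d -> chart_around (f p) d' ->
  local_diff c d' v = transition (f p) d d' (local_diff c d v).
Proof.
move=> cp dp dp'; rewrite /local_diff /transition.
have dcd := differentiable_local cp dp.
have fK : (cmap d \o f \o cinv c) (cmap c p) = cmap d (f p).
  by rewrite /= cmapK//; case: cp.
have ddd' : differentiable (cmap d' \o cinv d) ((cmap d \o f \o cinv c) (cmap c p)).
  by rewrite fK; exact: differentiable_transition.
have := diff_comp dcd ddd'; rewrite fK => E.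
have near_E : \forall x \near cmap c p,
    ((cmap d' \o cinv d) \o (cmap d \o f \o cinv c)) x
      = (cmap d' \o f \o cinv c) x.
  have : \forall q \near p, cdom d (f q).
    apply: smooth_map_continuous; apply: open_nbhs_nbhs; split; last exact: dp.2.
    exact: cdom_open.
  have : {for cmap c p, continuous (cinv c)}.
    by apply: cinv_continuous; exists p => //; exact: cp.2.
  rewrite /prop_for /continuous_at (cmapK cp.2).
  move=> cvgc /cvgc near_cd.
  have near_d : \forall x \near cmap c p, cdom d (f (cinv c x)) := near_cd.
  by apply: filterS near_d => x /= dx; rewrite (cmapK dx).
have [_ bdE] := near_eq_differential near_E (differentiable_comp dcd ddd').
exact: etrans (congr1 (@^~ v) bdE) (congr1 (@^~ v) E).
Qed.

Lemma local_diff_transr c c' d v :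
  chart_around p c -> chart_around p c' -> chart_around (f p) d ->
  local_diff c d v = local_diff c' d (transition p c c' v).
Proof.
move=> cp cp' dp; rewrite /local_diff /transition.
have dcc := differentiable_transition cp cp'.
have cK : (cmap c' \o cinv c) (cmap c p) = cmap c' p.
  by rewrite /= cmapK//; case: cp.
have dcd : differentiable (cmap d \o f \o cinv c') ((cmap c' \o cinv c) (cmap c p)).
  by rewrite cK; exact: differentiable_local.
have := diff_comp dcc dcd; rewrite cK => E.
have near_E : \forall x \near cmap c p,
    ((cmap d \o f \o cinv c') \o (cmap c' \o cinv c)) x
      = (cmap d \o f \o cinv c) x.
  have := near_cdom cp.2 cp'.2; apply: filterS => x cx.
  by rewrite /= (cmapK cx).
have [_ bdE] := near_eq_differential near_E (differentiable_comp dcc dcd).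
exact: etrans (congr1 (@^~ v) bdE) (congr1 (@^~ v) E).
Qed.

Definition pushforward_fun (v : tangent p) : tangent (f p) :=
  tangent_of (some_chartP (f p))
    (local_diff (some_chart p) (some_chart (f p)) (v (some_chart p))).

Lemma pushforward_funE v c d : chart_around p c -> chart_around (f p) d ->
  pushforward_fun v d = local_diff c d (v c).
Proof.
move=> cp dp; have sp := some_chartP p; have sfp := some_chartP (f p).
have E1 := tangent_coordE (pushforward_fun v) sfp dp.
have E2 := tangent_ofE sfp
  (local_diff (some_chart p) (some_chart (f p)) (v (some_chart p))).
have E3 := local_diff_transl (v (some_chart p)) sp sfp dp.
have E4 := local_diff_transr (v (some_chart p)) sp cp dp.
have E5 := tangent_coordE v sp cp.
rewrite E5 -E4 E3 E1; congr (transition _ _ _ _).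
exact: E2.
Qed.

Fact pushforward_linear : linear pushforward_fun.
Proof.
move=> a u v; have sp := some_chartP p; have sfp := some_chartP (f p).
apply: etrans (esym (tangent_ofK sfp _)) _.
apply: etrans (tangent_ofK sfp _).
congr (tangent_of _ _).
apply: etrans (pushforward_funE _ sp sfp) _.
apply: etrans (linearP (local_diff _ _) a (u (some_chart p)) (v (some_chart p))) _.
by congr (a *: _ + _); apply: esym; exact: pushforward_funE.
Qed.

HB.instance Definition _ := GRing.isLinear.Build R (tangent p) (tangent (f p))
  _ pushforward_fun pushforward_linear.

Definition pushforward : 'Hom(tangent p, tangent (f p)) := linfun pushforward_fun.

Lemma pushforwardE v c d : chart_around p c -> chart_around (f p) d ->
  pushforward v d = 'd (cmap d \o f \o cinv c) (cmap c p) (v c).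
Proof. by rewrite lfunE; exact: pushforward_funE. Qed.

End Pushforward.

Definition has_signature (R : realType) (V : vectType R) (g : {symmetric V})
    (a b : nat) :=
  exists e : (a + b).-tuple V, basis_of fullv e /\
    forall i j : 'I_(a + b), g e`_i e`_j =
      if i != j then 0 else if (i < a)%N then 1 else -1.

(* Tensor fields are smooth when they send smooth local vector fields to smooth
   objects; only the values of X and Y on U matter here. *)
Record almost_para_hermitian (R : realType) (m : nat) (M : manifold R m) :=
  AlmostParaHermitian {
  ph_phi : forall p : M, 'End(tangent p);
  ph_g : forall p : M, {symmetric (tangent p)};
  ph_phi_smooth : forall (U : set M) (X : vector_field M), open U ->
    smooth_vector_field_on U X ->
    smooth_vector_field_on U (fun p => ph_phi p (X p));
  ph_g_smooth : forall (U : set M) (X Y : vector_field M), open U ->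
    smooth_vector_field_on U X -> smooth_vector_field_on U Y ->
    smooth_function_on U (fun p => ph_g p (X p) (Y p));
  ph_even : ~~ odd m;
  ph_dim : (2 <= m)%N;
  ph_signature : forall p, has_signature (ph_g p) m./2 m./2;
  ph_phi_sqr : forall p, (ph_phi p \o ph_phi p)%VF = \1%VF;
  ph_eigenspaces : forall p,
    \dim (passmx.leigenspace (ph_phi p) 1) = \dim (passmx.leigenspace (ph_phi p) (-1));
  ph_compat : forall p (u v : tangent p),
    ph_g p (ph_phi p u) (ph_phi p v) = - ph_g p u v
}.

Section Immersion.
Context {R : realType} {m n : nat} {S : manifold R m} {M : manifold R n}.
Variables (hS : almost_para_hermitian S) (hM : almost_para_hermitian M) (f : smooth_map S M).

Definition immersion := forall p, injective (pushforward f p).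

Definition isometric_immersion := immersion /\
  forall p (u v : tangent p),
    ph_g hS p u v = ph_g hM (f p) (pushforward f p u) (pushforward f p v).

Definition tangent_image (p : S) : {vspace tangent (f p)} :=
  limg (pushforward f p).

Definition normal_fiber (p : S) : {vspace tangent (f p)} :=
  orthov (ph_g hM (f p)) (tangent_image p).

(* Meant to be applied on tangent_image p only: there, for f an isometric
   immersion, daddv_pi projects onto the normal space along its orthogonal
   complement tangent_image p. *)
Definition normal_map (p : S) : 'End(tangent (f p)) :=
  (daddv_pi (normal_fiber p) (tangent_image p) \o ph_phi hM (f p))%VF.

Definition slant_at (p : S) (lambda : R) :=
  forall v : tangent p,
    ph_phi hM (f p) (pushforward f p v) =
      lambda *: pushforward f p (ph_phi hS p v)
      + normal_map p (pushforward f p v).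

End Immersion.

Definition lorentz_frame (R : realType) (V : vectType R) (g : {symmetric V})
    (W : {vspace V}) (e e' : V) :=
  [/\ basis_of W [:: e; e'], g e e = 1, g e' e' = -1 & g e e' = 0].

(* Main.v *)
Require Import Defs.
From mathcomp Require Import all_boot all_order all_algebra sesquilinear.
From mathcomp Require Import all_classical all_reals topology normedtype derive.
From mathcomp Require Import ring lra.

Import Order.TTheory GRing.Theory Num.Theory.
Import numFieldNormedType.Exports.

Local Open Scope ring_scope.

(** The statement is linear algebra in the four-dimensional space V tangent to
    M at f p, with a nondegenerate symmetric form g and an involution phi that
    is skew for g, equivalently anti-isometric.  Write N for the orthogonal of
    the plane spanned by e1 and e2.  Slantness says that
    phi e1 = lambda e2 + a1 and phi e2 = lambda e1 + a2 with a1, a2 in N, and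
    since phi is an anti-isometry, g(a1, a1) = lambda^2 - 1,
    g(a2, a2) = 1 - lambda^2 and g(a1, a2) = 0 (slant_normal_gram).

    If |lambda| is not 1, then a1 and a2 divided by c_lambda form the frame
    (e3, e4), up to their order.

    If |lambda| = 1 and a1 is nonzero, then a1 is a null vector of N, and N is
    nondegenerate, so a1 is one half of a hyperbolic pair of N and can be
    written e3 + e4 in a Lorentz frame (null_normal_frame).  The vector a2 is
    null and orthogonal to a1, hence a2 = x a1, and a0 = 1.

    If |lambda| = 1 and a1 = 0, then a2 = 0 too, so phi preserves the plane of
    e1 and e2, hence N.  A vector n of N with g(n, n) = 1 then gives the frame
    (n, phi n), with a0 = 0 and epsilon = 1; such an n exists because phi
    exchanges the positive and the negative vectors of N.

    In every case but the last, phi e3 and phi e4 follow from phi e1 and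
    phi e2 by one computation: skewness gives all the entries of phi in the
    frame except the one, m, that couples e3 with e4, and phi (phi e1) = e1
    determines m (neutral_frame_involution). *)

(** * Symmetric bilinear forms *)

Section SymmetricForm.
Context {R : realType} {V : vectType R} (g : {symmetric V}).
Implicit Types u v w : V.

Lemma formC u v : g u v = g v u.
Proof. by rewrite hermC expr0 mul1r. Qed.

Lemma formDl u v w : g (u + v) w = g u w + g v w.
Proof. exact: linearDl. Qed.

Lemma formNl u w : g (- u) w = - g u w.
Proof. exact: linearNl. Qed.

Lemma formZl (a : R) u w : g (a *: u) w = a * g u w.
Proof. exact: linearZl_LR. Qed.

Lemma formDr u v w : g w (u + v) = g w u + g w v.
Proof. by rewrite formC formDl !(formC w). Qed.

Lemma formNr u w : g w (- u) = - g w u.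
Proof. by rewrite formC formNl formC. Qed.

Lemma formZr (a : R) u w : g w (a *: u) = a * g w u.
Proof. by rewrite formC formZl formC. Qed.

Definition formE := (formDl, formNl, formZl, formDr, formNr, formZr).

(** Pairing u with a vector of the diagonalizing basis returns, up to sign, the
    coordinate of u along that vector. *)
Lemma signature_nondegenerate {a b u} :
  has_signature g a b -> (forall w, g u w = 0) -> u = 0.
Proof.
move=> [e [ebas egram]] u0; rewrite (coord_basis ebas (memvf u)).
rewrite big1// => i _; have := u0 e`_i.
rewrite {1}(coord_basis ebas (memvf u)) formC linear_sumr/=.
rewrite (bigD1 i)//= big1 => [|j ji]; last first.
  by rewrite formZr egram eq_sym ji mulr0.
rewrite addr0 formZr egram eqxx/=.
case: ifP => _ => [|/eqP]; first by rewrite mulr1 => ->; rewrite scale0r.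
by rewrite mulrN1 oppr_eq0 => /eqP ->; rewrite scale0r.
Qed.

(** * Neutral frames in dimension four *)

Definition lorentz_pair u v := [/\ g u u = 1, g v v = -1 & g u v = 0].

Lemma lorentz_pair_residual u v (w : V) :
  lorentz_pair u v ->
  let w' := w - g w u *: u + g w v *: v in g w' u = 0 /\ g w' v = 0.
Proof.
by case=> guu gvv guv w'; rewrite /w' !formE (formC v u) guu gvv guv; split; ring.
Qed.

Lemma mem_orthov_span2 u v w :
  reflect (g w u = 0 /\ g w v = 0) (w \in orthov g <<[:: u; v]>>).
Proof.
apply: (iffP mem_orthovP) => [w0|[wu wv] x].
  by split; apply: w0; apply: memv_span; rewrite !inE eqxx ?orbT.
rewrite span_def big_cons big_seq1 => /memv_addP[_ /vlineP[a ->]].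
by move=> [_ /vlineP[b ->] ->]; rewrite !formE wu wv !mulr0 addr0.
Qed.

(** The cross orthogonality is a membership and not four vanishing products,
    because e3 and e4 are built from vectors of the orthogonal plane. *)
Definition neutral_frame e1 e2 e3 e4 :=
  [/\ lorentz_pair e1 e2, lorentz_pair e3 e4,
      e3 \in orthov g <<[:: e1; e2]>> & e4 \in orthov g <<[:: e1; e2]>>].

Section Frame.
Context {e1 e2 e3 e4 : V} (dimV : \dim {:V} = 4%N)
        (frame : neutral_frame e1 e2 e3 e4).

(** The Gram matrix, as a rewriting multirule: after formE it evaluates g on
    any two combinations of the frame. *)
Lemma neutral_frame_gram :
  (((g e1 e1 = 1) * (g e1 e2 = 0) * (g e1 e3 = 0) * (g e1 e4 = 0)) *
  ((g e2 e1 = 0) * (g e2 e2 = -1) * (g e2 e3 = 0) * (g e2 e4 = 0)) *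
  ((g e3 e1 = 0) * (g e3 e2 = 0) * (g e3 e3 = 1) * (g e3 e4 = 0)) *
  ((g e4 e1 = 0) * (g e4 e2 = 0) * (g e4 e3 = 0) * (g e4 e4 = -1)))%type.
Proof.
case: frame => -[g11 g22 g12] [g33 g44 g34].
move=> /mem_orthov_span2[g31 g32] /mem_orthov_span2[g41 g42].
by do ![split]; rewrite // formC.
Qed.

Lemma neutral_frame_free : free [:: e1; e2; e3; e4].
Proof.
have gr := neutral_frame_gram.
apply/(@freeP _ _ _ [tuple e1; e2; e3; e4]) => k.
rewrite !big_ord_recl big_ord0 /= addr0 => k0.
have pair0 v : g (k ord0 *: e1 + (k (lift ord0 ord0) *: e2 +
   (k (lift ord0 (lift ord0 ord0)) *: e3 +
    k (lift ord0 (lift ord0 (lift ord0 ord0))) *: e4))) v = 0.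
  by rewrite k0 -(scale0r v) formZl mul0r.
move: (pair0 e1) (pair0 e2) (pair0 e3) (pair0 e4).
rewrite !formE !gr => h1 h2 h3 h4 [[|[|[|[|//]]]] lti].
- by rewrite (_ : Ordinal lti = ord0); [lra|exact/val_inj].
- by rewrite (_ : Ordinal lti = lift ord0 ord0); [lra|exact/val_inj].
- by rewrite (_ : Ordinal lti = lift ord0 (lift ord0 ord0)); [lra|exact/val_inj].
- by rewrite (_ : Ordinal lti = lift ord0 (lift ord0 (lift ord0 ord0)));
    [lra|exact/val_inj].
Qed.

Lemma neutral_frame_expand u :
  u = g u e1 *: e1 - g u e2 *: e2 + g u e3 *: e3 - g u e4 *: e4.
Proof.
have gr := neutral_frame_gram.
have ebas : basis_of fullv [tuple e1; e2; e3; e4].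
  by rewrite basisEfree neutral_frame_free subvf dimV.
have := coord_basis ebas (memvf u).
rewrite !big_ord_recl big_ord0 /= addr0.
move: (coord _ _ u) (coord _ _ u) (coord _ _ u) (coord _ _ u) => a b c d ->.
rewrite !formE !gr !(mulr0, mulr1, mulrN1, addr0, add0r, opprK).
by rewrite !scaleNr !opprK !addrA.
Qed.

Lemma neutral_frame_ext u v :
  g u e1 = g v e1 -> g u e2 = g v e2 -> g u e3 = g v e3 -> g u e4 = g v e4 ->
  u = v.
Proof.
move=> h1 h2 h3 h4.
by rewrite (neutral_frame_expand u) (neutral_frame_expand v) h1 h2 h3 h4.
Qed.

(** In the expansion of a vector along the frame, the coordinates on e1 and e2
    are its products with e1 and e2, so they vanish on the orthogonal plane. *)
Lemma neutral_frame_normal : basis_of (orthov g <<[:: e1; e2]>>) [:: e3; e4].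
Proof.
have [_ _ N3 N4] := frame.
rewrite /basis_of -[[:: e3; e4]]/(drop 2 [:: e1; e2; e3; e4]).
have -> : free (drop 2 [:: e1; e2; e3; e4]).
  have := neutral_frame_free; rewrite -[X in free X](cat_take_drop 2).
  exact: catr_free.
rewrite andbT /= eqEsubv; apply/andP; split.
  by apply/span_subvP => x; rewrite !inE => /orP[] /eqP ->.
apply/subvP => u /mem_orthov_span2[u1 u2].
rewrite (neutral_frame_expand u) u1 u2 !scale0r subr0 add0r.
by rewrite rpredB ?rpredZ// memv_span// !inE eqxx ?orbT.
Qed.

End Frame.

(** * Skew involutions in a neutral frame *)

Section Skew.
Context (phi : 'End(V)) (phiK : forall u, phi (phi u) = u)
        (phi_skew : forall u v, g (phi u) v = - g u (phi v)).

Lemma skew_diag u : g (phi u) u = 0.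
Proof. by have := phi_skew u u; rewrite (formC u); lra. Qed.

(** The products of phi e3 and phi e4 with e1 and e2 are known by skewness, and
    g (phi e3) e3 = g (phi e4) e4 = 0; the only entry left is
    m = - g (phi e3) e4.  The last two equations are the e4 and e3 components
    of phi (phi e1) = e1. *)
Lemma neutral_frame_involution {e1 e2 e3 e4} {l a b c d : R} :
  \dim {:V} = 4%N -> neutral_frame e1 e2 e3 e4 ->
  phi e1 = l *: e2 + (a *: e3 + b *: e4) ->
  phi e2 = l *: e1 + (c *: e3 + d *: e4) ->
  exists m : R, [/\ phi e3 = - a *: e1 + c *: e2 + m *: e4,
    phi e4 = b *: e1 - d *: e2 + m *: e3, m * a = - (l * d) & m * b = - (l * c)].
Proof.
move=> dimV frame p1 p2; have gr := neutral_frame_gram frame.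
have p34 : g (phi e4) e3 = - g (phi e3) e4 by rewrite phi_skew formC.
have p3 : phi e3 = - a *: e1 + c *: e2 + (- g (phi e3) e4) *: e4.
  apply: (neutral_frame_ext dimV frame); rewrite !formE !gr ?skew_diag.
  - by rewrite phi_skew p1 !formE !gr; ring.
  - by rewrite phi_skew p2 !formE !gr; ring.
  - by ring.
  - by ring.
have p4 : phi e4 = b *: e1 - d *: e2 + (- g (phi e3) e4) *: e3.
  apply: (neutral_frame_ext dimV frame); rewrite !formE !gr ?skew_diag.
  - by rewrite phi_skew p1 !formE !gr; ring.
  - by rewrite phi_skew p2 !formE !gr; ring.
  - by rewrite p34; ring.
  - by ring.
move: (- g (phi e3) e4) p3 p4 => m p3 p4; exists m.
have p11 : l *: phi e2 + (a *: phi e3 + b *: phi e4) = e1.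
  by rewrite -!linearZ -!linearD/= -p1.
rewrite p2 p3 p4 in p11; split=> //.
- by have := congr1 (g ^~ e4) p11; rewrite !formE !gr; lra.
- by have := congr1 (g ^~ e3) p11; rewrite !formE !gr; lra.
Qed.

(** * Slant planes *)

Section Slant.
Context (dimV : \dim {:V} = 4%N) {e1 e2 a1 a2 : V} {l : R}.
Local Notation N := (orthov g <<[:: e1; e2]>>).
Context (e12 : lorentz_pair e1 e2)
        (N1 : a1 \in N)
        (N2 : a2 \in N)
        (p1 : phi e1 = l *: e2 + a1) (p2 : phi e2 = l *: e1 + a2).

(** Expand g (phi ei) (phi ej) = - g ei ej; the products of e1, e2 with a1, a2
    vanish. *)
Lemma slant_normal_gram :
  [/\ g a1 a1 = l ^+ 2 - 1, g a2 a2 = 1 - l ^+ 2 & g a1 a2 = 0].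
Proof.
have [g11 g22 g12] := e12.
have /mem_orthov_span2[ga11 ga12] := N1.
have /mem_orthov_span2[ga21 ga22] := N2.
have anti u v : g (phi u) (phi v) = - g u v by rewrite phi_skew phiK.
have := anti e1 e1; have := anti e2 e2; have := anti e1 e2.
rewrite p1 p2 !formE (formC e2 e1) (formC e2 a1) (formC e1 a2).
rewrite (formC e2 a2) g11 g22 g12 ga11 ga12 ga21 ga22 => h12 h22 h11.
by split; [lra|lra|lra].
Qed.

(** Here g a1 a1 is positive, so a1 gives e3. *)
Lemma slant_frame_gt1 : 1 < `|l| ->
  let c := Num.sqrt (l ^+ 2 - 1) in
  exists e3 e4, neutral_frame e1 e2 e3 e4 /\
    [/\ phi e1 = l *: e2 + c *: e3, phi e2 = l *: e1 + c *: e4,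
        phi e3 = - c *: e1 - l *: e4 & phi e4 = - c *: e2 - l *: e3].
Proof.
move=> l1 c; have [ga1 ga2 ga12] := slant_normal_gram.
have l2 : 0 < l ^+ 2 - 1 by rewrite subr_gt0 -real_normK ?num_real// expr_gt1.
have c0 : c != 0 by rewrite gt_eqF// sqrtr_gt0.
have cc : c ^+ 2 = l ^+ 2 - 1 by rewrite sqr_sqrtr// ltW.
have frame : neutral_frame e1 e2 (c^-1 *: a1) (c^-1 *: a2).
  split; rewrite ?rpredZ//; split; rewrite !formE ?ga12 ?mulr0//.
    by rewrite ga1 -cc; field.
  by rewrite ga2 -opprB -cc; field.
exists (c^-1 *: a1), (c^-1 *: a2); split=> //.
have q1 : phi e1 = l *: e2 + (c *: (c^-1 *: a1) + 0 *: (c^-1 *: a2)).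
  by rewrite scale0r addr0 scalerA divff// scale1r.
have q2 : phi e2 = l *: e1 + (0 *: (c^-1 *: a1) + c *: (c^-1 *: a2)).
  by rewrite scale0r add0r scalerA divff// scale1r.
have [m [q3 q4 mc _]] := neutral_frame_involution dimV frame q1 q2.
have {mc} ml : m = - l by apply: (mulIf c0); rewrite mc mulNr.
by split; rewrite ?q1 ?q2 ?q3 ?q4 ?ml !(scale0r, add0r, addr0) -?scaleNr.
Qed.

(** Here g a1 a1 is negative, so a1 gives e4: the two normal vectors exchange
    their roles. *)
Lemma slant_frame_lt1 : `|l| < 1 ->
  let c := Num.sqrt (1 - l ^+ 2) in
  exists e3 e4, neutral_frame e1 e2 e3 e4 /\
    [/\ phi e1 = l *: e2 + c *: e4, phi e2 = l *: e1 + c *: e3,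
        phi e3 = c *: e2 - l *: e4 & phi e4 = c *: e1 - l *: e3].
Proof.
move=> l1 c; have [ga1 ga2 ga12] := slant_normal_gram.
have l2 : 0 < 1 - l ^+ 2 by rewrite subr_gt0 -real_normK ?num_real// expr_lt1.
have c0 : c != 0 by rewrite gt_eqF// sqrtr_gt0.
have cc : c ^+ 2 = 1 - l ^+ 2 by rewrite sqr_sqrtr// ltW.
have frame : neutral_frame e1 e2 (c^-1 *: a2) (c^-1 *: a1).
  split; rewrite ?rpredZ//; split; rewrite !formE ?(formC a2) ?ga12 ?mulr0//.
    by rewrite ga2 -cc; field.
  by rewrite ga1 -opprB -cc; field.
exists (c^-1 *: a2), (c^-1 *: a1); split=> //.
have q1 : phi e1 = l *: e2 + (0 *: (c^-1 *: a2) + c *: (c^-1 *: a1)).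
  by rewrite scale0r add0r scalerA divff// scale1r.
have q2 : phi e2 = l *: e1 + (c *: (c^-1 *: a2) + 0 *: (c^-1 *: a1)).
  by rewrite scale0r addr0 scalerA divff// scale1r.
have [m [q3 q4 _ mc]] := neutral_frame_involution dimV frame q1 q2.
have {mc} ml : m = - l by apply: (mulIf c0); rewrite mc mulNr.
split; rewrite ?q1 ?q2 ?q3 ?q4 ?ml !(scale0r, oppr0, add0r, addr0) -?scaleNr//.
Qed.

Context (nondeg : forall u, (forall w, g u w = 0) -> u = 0).

(** Nondegeneracy passes from V to N: replacing w by its residual in N does not
    change its product with a vector of N. *)
Lemma normal_dual {u} : u \in N -> u != 0 ->
  exists2 w, w \in N & g u w = 1.
Proof.
move=> Nu u0; have [w guw] : exists w, g u w != 0.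
  by apply/not_existsP => u0'; case/eqP: u0; apply: nondeg => w;
    apply/eqP/negPn/negP/u0'.
have /mem_orthov_span2[gu1 gu2] := Nu.
pose w' := w - g w e1 *: e1 + g w e2 *: e2.
have Nw' : w' \in N.
  exact/mem_orthov_span2/lorentz_pair_residual.
exists ((g u w)^-1 *: w'); first by rewrite rpredZ.
by rewrite /w' !formE gu1 gu2 !mulr0 oppr0 !addr0 mulVf.
Qed.

(** N is nonzero because two vectors cannot span V; if n in N is nonzero and
    g n w = 1 with n and w both null, then n + w has square 2. *)
Lemma nonnull_normal : exists2 n, n \in N & g n n != 0.
Proof.
have [u Wu] : exists u, u \notin <<[:: e1; e2]>>%VS.
  apply/not_existsP => Wall; suff : (\dim {:V} <= 2)%N by rewrite dimV.
  apply: leq_trans (dim_span [:: e1; e2]); apply/dimvS/subvP => u _.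
  exact/negPn/negP/Wall.
pose n := u - g u e1 *: e1 + g u e2 *: e2.
have Nn : n \in N.
  exact/mem_orthov_span2/lorentz_pair_residual.
have n0 : n != 0.
  apply: contra Wu => /eqP n0; have -> : u = g u e1 *: e1 - g u e2 *: e2.
    by apply/eqP; rewrite -subr_eq0 opprB addrA addrAC -/n n0.
  by rewrite rpredB ?rpredZ// memv_span// !inE eqxx ?orbT.
move: n Nn n0 => n Nn n0; have [w Nw gnw] := normal_dual Nn n0.
have [gnn|] := eqVneq (g n n) 0; last by exists n.
have [gww|] := eqVneq (g w w) 0; last by exists w.
exists (n + w); first by rewrite rpredD.
have -> : g (n + w) (n + w) = 2 by rewrite !formE gnn gww (formC w) gnw; ring.
by rewrite pnatr_eq0.
Qed.

(** A nonzero null vector of N belongs to a hyperbolic pair (a, b) of N, whose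
    combinations a / 2 + b and a / 2 - b have squares 1 and -1. *)
Lemma null_normal_frame {a} :
  a \in N -> a != 0 -> g a a = 0 ->
  exists e3 e4, neutral_frame e1 e2 e3 e4 /\ a = e3 + e4.
Proof.
move=> Na a0 gaa; have [w Nw gaw] := normal_dual Na a0.
(* The null vector b such that (a, b) is a hyperbolic pair. *)
pose b := w - (g w w / 2) *: a.
have Nb : b \in N by rewrite rpredB ?rpredZ.
have gbb : g b b = 0 by rewrite /b !formE (formC w a) gaa gaw; field.
have gab : g a b = 1 by rewrite /b !formE gaa gaw; ring.
move: b Nb gbb gab => b Nb gbb gab.
exists (2^-1 *: a + b), (2^-1 *: a - b); split.
  split; rewrite ?rpredD ?rpredB ?rpredN ?rpredZ//.
  by split; rewrite !formE (formC b a) gaa gbb gab; field.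
by rewrite addrACA subrr addr0 -scalerDl -div1r -splitr scale1r.
Qed.

Lemma slant_frame_eq1 : `|l| = 1 ->
  exists e3 e4, neutral_frame e1 e2 e3 e4 /\
    exists eps a0 : R, (eps = 1 \/ eps = -1) /\
    [/\ phi e1 = l *: e2 + a0 *: (e3 + e4),
        phi e2 = l *: e1 - (eps / l * a0) *: (e3 + e4),
        phi e3 = eps *: e4 - a0 *: (e1 + (eps / l) *: e2) &
        phi e4 = eps *: e3 + a0 *: (e1 + (eps / l) *: e2)].
Proof.
move=> l1; have [ga1 ga2 ga12] := slant_normal_gram.
have ll : l * l = 1 by rewrite -expr2 -real_normK ?num_real// l1 expr1n.
have l0 : l != 0 by rewrite -normr_eq0 l1 oner_neq0.
have [a10|a10] := eqVneq a1 0.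
  have q1 : phi e1 = l *: e2 by rewrite p1 a10 addr0.
  have q2 : phi e2 = l *: e1.
    by rewrite -(phiK e1) q1 linearZ/= scalerA ll scale1r.
  have phiN n : n \in N -> phi n \in N.
    move=> /mem_orthov_span2[n1 n2]; apply/mem_orthov_span2.
    by rewrite !phi_skew q1 q2 !formE n1 n2 !mulr0 oppr0.
  suff [n Nn gn] : exists2 n, n \in N & g n n = 1.
    exists n, (phi n); split.
      split=> //; last exact: phiN.
      by split=> //; [rewrite phi_skew phiK gn|rewrite formC skew_diag].
    exists 1, 0; rewrite !scale0r !mulr0 !scale0r !addr0 !subr0 !scale1r phiK.
    by split; [left|].
  have [n Nn gn] := nonnull_normal.
  (* phi maps N to itself and reverses the sign of g n n. *)
  wlog gn0 : n Nn gn / 0 < g n n.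
    move=> H; have [|gn0|gn0] := ltrgt0P (g n n); first exact: H.
      apply: (H (phi n)); first exact: phiN.
        by rewrite phi_skew phiK oppr_eq0.
      by rewrite phi_skew phiK oppr_gt0.
    by rewrite gn0 eqxx in gn.
  exists ((Num.sqrt (g n n))^-1 *: n); first by rewrite rpredZ.
  have s0 : Num.sqrt (g n n) != 0 by rewrite gt_eqF// sqrtr_gt0.
  by rewrite !formE -{3}[g n n]sqr_sqrtr ?ltW//; field.
have [e3 [e4 [frame a1E]]] : exists e3 e4, neutral_frame e1 e2 e3 e4 /\ a1 = e3 + e4.
  by apply: null_normal_frame => //; rewrite ga1 expr2 ll subrr.
have gr := neutral_frame_gram frame.
have a2E : a2 = g a2 e3 *: a1.
  have /mem_orthov_span2[g21 g22] := N2.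
  (* This is the orthogonality of a2 and a1 = e3 + e4. *)
  have g34 : g a2 e4 = - g a2 e3.
    by move: ga12; rewrite a1E formC !formE => /eqP; rewrite addrC addr_eq0 => /eqP.
  rewrite {1}(neutral_frame_expand dimV frame a2) g21 g22 g34 a1E scalerDr.
  by rewrite !scale0r subrr add0r scaleNr opprK.
move: (g a2 e3) a2E => x a2E.
have q1 : phi e1 = l *: e2 + (1 *: e3 + 1 *: e4) by rewrite !scale1r -a1E.
have q2 : phi e2 = l *: e1 + (x *: e3 + x *: e4).
  by rewrite -scalerDr -a1E -a2E.
have [m [q3 q4 mlx _]] := neutral_frame_involution dimV frame q1 q2.
(* g (phi e3) (phi e3) = - 1 reads 1 - x ^+ 2 - m ^+ 2 = - 1, where
   m ^+ 2 = x ^+ 2. *)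
have x1 : x ^+ 2 = 1.
  have := phi_skew e3 (phi e3); rewrite phiK q3 !formE !gr.
  have -> : m = - (l * x) by rewrite -mlx mulr1.
  have : (l * x) * (l * x) = x ^+ 2 by rewrite mulrACA ll mul1r.
  by lra.
have mx : m / l = - x by apply: (mulIf l0); rewrite divfK// -(mulr1 m) mlx; ring.
(* epsilon = m = - l x, so that - (epsilon / l) a0 = x. *)
exists e3, e4; split=> //; exists m, 1; split.
  have : m ^+ 2 = 1 by rewrite -(mulr1 m) mlx sqrrN exprMn x1 expr2 ll mulr1.
  by move=> /eqP; rewrite sqrf_eq1 => /orP[] /eqP; [left|right].
rewrite mx mulr1 q1 q2 q3 q4 !scaleNr !scale1r; split.
- by [].
- by rewrite opprK scalerDr.
- by rewrite opprB addrC [- e1 + _]addrC.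
- by rewrite addrC.
Qed.

End Slant.
End Skew.
End SymmetricForm.

(** * Slant immersions of surfaces *)

Theorem proposition2 (R : realType) (S : manifold R 2) (M : manifold R 4)
    (hS : almost_para_hermitian S) (hM : almost_para_hermitian M) (f : smooth_map S M)
    (hf : isometric_immersion hS hM f) (p : S) (lambda : R)
    (hslant : slant_at hS hM f p lambda) (v1 v2 : tangent p)
    (hframe : lorentz_frame (ph_g hS p) fullv v1 v2)
    (hv2 : v2 = ph_phi hS p v1) :
  let phi := ph_phi hM (f p) in
  let e1 := pushforward f p v1 in
  let e2 := pushforward f p v2 in
  exists e3 e4 : tangent (f p),
    [/\ lorentz_frame (ph_g hM (f p)) (normal_fiber hM f p) e3 e4,
        1 < `|lambda| ->
          let c := Num.sqrt (lambda ^+ 2 - 1) in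
          [/\ phi e1 = lambda *: e2 + c *: e3,
              phi e2 = lambda *: e1 + c *: e4,
              phi e3 = - c *: e1 - lambda *: e4 &
              phi e4 = - c *: e2 - lambda *: e3],
        `|lambda| < 1 ->
          let c := Num.sqrt (1 - lambda ^+ 2) in
          [/\ phi e1 = lambda *: e2 + c *: e4,
              phi e2 = lambda *: e1 + c *: e3,
              phi e3 = c *: e2 - lambda *: e4 &
              phi e4 = c *: e1 - lambda *: e3] &
        `|lambda| = 1 ->
          exists eps a0 : R, (eps = 1 \/ eps = -1) /\
          [/\ phi e1 = lambda *: e2 + a0 *: (e3 + e4),
              phi e2 = lambda *: e1 - (eps / lambda * a0) *: (e3 + e4),
              phi e3 = eps *: e4 - a0 *: (e1 + (eps / lambda) *: e2) &
              phi e4 = eps *: e3 + a0 *: (e1 + (eps / lambda) *: e2)]].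
Proof.
move=> phi e1 e2; set g := ph_g hM (f p).
have [[vbas g11 g22 g12] [_ isom]] := (hframe, hf).
have dimV : \dim {:tangent (f p)} = 4%N by rewrite dimvf.
have phiK u : phi (phi u) = u.
  by have := congr1 (fun h : 'End(_) => h u) (ph_phi_sqr hM (f p)); rewrite !lfunE.
have phi_skew u v : g (phi u) v = - g u (phi v).
  by have := ph_compat hM u (phi v); rewrite -/phi phiK.
have e12 : lorentz_pair g e1 e2 by split; rewrite /g -isom.
have NE : normal_fiber hM f p = orthov g <<[:: e1; e2]>>.
  by rewrite /normal_fiber /tangent_image -(span_basis vbas) limg_span.
have phi2 : ph_phi hS p v2 = v1.
  by have := congr1 (fun h : 'End(_) => h v1) (ph_phi_sqr hS p);
    rewrite !lfunE hv2.
have N v : normal_map hM f p v \in orthov g <<[:: e1; e2]>>.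
  by rewrite -NE lfunE/= memv_pi.
have p1 := hslant v1; have p2 := hslant v2.
rewrite -hv2 -/phi -/e1 -/e2 in p1; rewrite phi2 -/phi -/e1 -/e2 in p2.
have nondeg u : (forall w, g u w = 0) -> u = 0.
  exact: (signature_nondegenerate _ (ph_signature hM (f p))).
have normal e3 e4 : neutral_frame g e1 e2 e3 e4 ->
    lorentz_frame g (normal_fiber hM f p) e3 e4.
  move=> frame; rewrite NE; have [_ [g33 g44 g34] _ _] := frame.
  by split=> //; exact: neutral_frame_normal _ dimV frame.
have [l1|l1|l1] := ltrgtP `|lambda| 1.
- have [e3 [e4 [frame E]]] :=
    slant_frame_lt1 _ _ phiK phi_skew dimV e12 (N _) (N _) p1 p2 l1.
  by exists e3, e4; split=> //; [exact: normal|move=> l1'; move: l1 l1'; clear; lra..].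
- have [e3 [e4 [frame E]]] :=
    slant_frame_gt1 _ _ phiK phi_skew dimV e12 (N _) (N _) p1 p2 l1.
  by exists e3, e4; split=> //; [exact: normal|move=> l1'; move: l1 l1'; clear; lra..].
- have [e3 [e4 [frame E]]] :=
    slant_frame_eq1 _ _ phiK phi_skew dimV e12 (N _) (N _) p1 p2 nondeg l1.
  by exists e3, e4; split=> //; [exact: normal|move=> l1'; move: l1 l1'; clear; lra..].
Qed.
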